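(* Let $\mathcal{N}$ be the poset with four elements $A,B,C,D$ whose only strict relations are $A<C$, $B<C$ and $B<D$ (so $A\parallel B$, $A\parallel D$ and $C\parallel D$). Then, as $n\to\infty$ (with the lower bound holding for all sufficiently large $n$), $$n+\frac{n}{15\log n}\le R(\mathcal{N},Q_n)\le n+\frac{(1+o(1))\,n}{\log n}.$$
   Context: $Q_n$ denotes the Boolean lattice of dimension $n$, i.e. the poset of all subsets of an $n$-element set ordered by inclusion. For posets $P,P'$, a (induced) copy of $P$ in $P'$ is a subset of $P'$ which, with the order induced from $P'$, is isomorphic to $P$; that is, the image of an injective map $f\colon P\to P'$ with $A\le_P B$ if and only if $f(A)\le_{P'} f(B)$. A blue/red coloring of a poset assigns to each of its elements the color blue or red; a copy is blue (red) if all of its elements are blue (red). For posets $P,Q$, the poset Ramsey number $R(P,Q)$ is the least positive integer $N$ such that every blue/red coloring of $Q_N$ contains a blue copy of $P$ or a red copy of $Q$. $A\parallel B$ means that $A$ and $B$ are incomparable. The logarithm $\log$ is to base $2$, and $o(1)$ denotes a quantity tending to $0$ as $n\to\infty$. *)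

(* Defs.v *)
From HB Require Import structures.
From mathcomp Require Import all_boot all_order all_algebra.
From mathcomp Require Import all_classical all_reals all_analysis.

Set Implicit Arguments.
Unset Strict Implicit.
Unset Printing Implicit Defensive.

Import Order.TTheory GRing.Theory Num.Theory.
Import preorder.Order.SetSubsetOrder.Exports order.Order.SetSubsetOrder.Exports.
Import numFieldNormedType.Exports.

Local Open Scope classical_set_scope.
Local Open Scope order_scope.

Variant color := Blue | Red.

Definition poset_embedding {d d' : Order.disp_t} {P : porderType d}
    {P' : porderType d'} (f : P -> P') : Prop :=
  injective f /\ {mono f : A B / A <= B}.

Definition is_copy {d d' : Order.disp_t} (P : porderType d)
    (P' : porderType d') (S : set P') : Prop :=
  exists2 f : P -> P', poset_embedding f & S = range f.

Definition monochromatic {T : Type} (c : T -> color) (k : color) (S : set T) :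
  Prop := forall A, S A -> c A = k.

(* An alias of [{set 'I_n}] whose canonical order is [\subset]. *)
Definition boolean_lattice (n : nat) := {subset 'I_n}.
HB.instance Definition _ (n : nat) :=
  Order.CTBDistrLattice.on (boolean_lattice n).
HB.instance Definition _ (n : nat) := Finite.on (boolean_lattice n).

Section PosetRamsey.
Context {d d' : Order.disp_t}.

Definition ramsey_arrow (P : porderType d) (Q : porderType d') (N : nat) :
    Prop :=
  forall c : boolean_lattice N -> color,
    (exists2 S, is_copy P S & monochromatic c Blue S) \/
    (exists2 S, is_copy Q S & monochromatic c Red S).

Definition is_poset_ramsey (P : porderType d) (Q : porderType d') (N : nat) :
    Prop :=
  [/\ (0 < N)%N, ramsey_arrow P Q N &
      forall M : nat, (0 < M)%N -> ramsey_arrow P Q M -> (N <= M)%N].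

(* The default value 0 is never a legitimate value, so a positive lower bound
   on [poset_ramsey P Q] entails that the minimum is attained. *)
Definition poset_ramsey (P : porderType d) (Q : porderType d') : nat :=
  xget 0%N [set N | is_poset_ramsey P Q N].

End PosetRamsey.

Variant N_poset := NA | NB | NC | ND.

Definition N_lt (x y : N_poset) : bool :=
  match x, y with
  | NA, NC | NB, NC | NB, ND => true
  | _, _ => false
  end.

Definition N_code (x : N_poset) : bool * bool :=
  match x with
  | NA => (false, false) | NB => (false, true)
  | NC => (true, false) | ND => (true, true)
  end.

Definition N_decode (b : bool * bool) : N_poset :=
  match b with
  | (false, false) => NA | (false, true) => NB
  | (true, false) => NC | (true, true) => ND
  end.

Lemma N_codeK : cancel N_code N_decode. Proof. by case. Qed.

HB.instance Definition _ := Finite.copy N_poset (can_type N_codeK).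

Definition N_le (x y : N_poset) : bool := (x == y) || N_lt x y.

Lemma N_lt_def (x y : N_poset) : N_lt x y = (y != x) && N_le x y.
Proof. by case: x; case: y. Qed.

Lemma N_le_refl : reflexive N_le. Proof. by case. Qed.

Lemma N_le_anti : antisymmetric N_le. Proof. by case=> -[]. Qed.

Lemma N_le_trans : transitive N_le. Proof. by case=> -[] []. Qed.

Fact N_display : Order.disp_t. Proof. exact: Order.Disp tt tt. Qed.

HB.instance Definition _ := Order.isPOrder.Build N_display N_poset
  N_lt_def N_le_refl N_le_anti N_le_trans.

Definition log2 {R : realType} (x : R) : R := (ln x / ln 2)%R.

(* Main.v *)
Require Import Defs.
From mathcomp Require Import all_classical all_reals all_analysis.
From mathcomp Require Import all_boot all_order all_fingroup all_algebra all_field.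
From mathcomp Require Import zify ring lra.
Import Order.TTheory GRing.Theory Num.Theory.
Import numFieldNormedType.Exports.

(** Upper bound.  Color [Q_(n+k)] without a blue copy of N, and let [F] be the
    family of blue sets.  Split the ground set into [n] points and [k] extra
    points.  For every ordering [tau] of the extra points, insert them greedily
    into the subsets of the [n] points, as few as possible and monotonically, so
    as to reach red sets only: this yields a red [Q_n], unless it gets stuck
    along a blue chain whose members contain exactly the first 0, 1, ..., [k]
    extra points in the order [tau] ([red_cube_of_not_stuck], [stuck_chain]).
    Such a chain determines [tau], so without a red [Q_n] the family [F] has at
    least [k`!] maximal chains.  But [F] is N-free, hence series-parallel
    ([N_free_decomposition]), and a series-parallel family of subsets of an
    [m]-element set has at most [2 ^ m] maximal chains
    ([card_max_chains_N_free]).  So [2 ^ (n + k) < k`!] forces a red [Q_n], and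
    this holds from [k = (1 + o(1)) n / log n] on.

    Lower bound.  Up to a relabelling, a copy of [Q_n] in the subsets of an
    [(n + k)]-element set [U] is described by an [n]-set [X]: the copy [f A] of
    [A] meets [X] exactly in [A] ([embedding_coordinates]).  For every [k]-set
    [Y], a candidate for the complement of [X], color blue a tree of sets, a
    shrub, indexed by the sequences [S] of distinct points of [Y]: the node of
    [S] meets [Y] exactly in the points of [S] and, outside [Y], records [S]
    itself in such a way that inclusion of nodes is the prefix order.  Walking
    up that tree along a copy of [Q_n] whose coordinates are the complement of
    [Y] always meets a node ([node_in_every_cube]), so no copy of [Q_n] is red.
    If nodes of different shrubs are never comparable, then the blue sets below
    a given blue set form a chain ([nodes_below_chain]), so no copy of N is blue.
    Incomparability is arranged by an error-correcting code.  The ground set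
    carries blocks of [2 * t] points, each of which stores a symbol of the field
    with [2 ^ t] elements, [t] being about [log n].  A shrub stores a
    Reed-Solomon codeword of [Y] in [3 * k + 1] blocks and its sequences in
    [2 * k] others, leaving out the blocks that [Y] itself meets, of which there
    are at most [k].  For large [n], there is room for these
    [(5 * k + 1) * (2 * t)] points as long as [k <= n / (15 * log n)]. *)

Set Implicit Arguments.
Unset Strict Implicit.
Unset Printing Implicit Defensive.

(** * N-free families of sets are series-parallel *)
Section NFree.
Variable T : finType.
Implicit Types (A B q U : {set T}) (F G H C : {set {set T}}).

(** Given the three inclusions, an induced copy of N is characterized by the three
    non-inclusions negated here: by transitivity, they entail all the others,
    and that the four sets are distinct. *)
Definition N_free F := forall A B (C D : {set T}),
  A \in F -> B \in F -> C \in F -> D \in F ->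
  A \subset C -> B \subset C -> B \subset D ->
  [|| A \subset D, B \subset A | D \subset C].

Definition parallel F G := forall A B,
  A \in F -> B \in G -> ~~ (A \subset B) && ~~ (B \subset A).

Definition below F G := forall A B, A \in F -> B \in G -> A \subset B.

Lemma N_free_sub F G : G \subset F -> N_free F -> N_free G.
Proof.
by move=> /subsetP sGF NF A B C D /sGF AF /sGF BF /sGF CF /sGF DF; apply: NF.
Qed.

(** Induction on the family, adding back a set [x] of maximal cardinality to a
    decomposition [F1], [F2] of the rest.  Either [x] can join one of the two
    sides, or the sets of [F] below [x] and those that are not can be
    separated: a comparability between the two kinds that contradicted this
    would complete a copy of N with [x] and a suitable member of [F1] or [F2]. *)
Lemma N_free_decomposition F : N_free F -> 1 < #|F| ->
  exists F1 F2, [/\ F1 != set0, F2 != set0, F1 :|: F2 = F, [disjoint F1 & F2]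
                  & parallel F1 F2 \/ below F1 F2].
Proof.
elim: {F}#|F| {-2}F (leqnn #|F|) => [|m IH] F leFm NF F_gt1; first by lia.
have [x0 x0F] : exists x0, x0 \in F by apply/card_gt0P; lia.
pose x := [arg max_(X > x0 in F) #|X|].
have [xF xmax] : x \in F /\ forall X, X \in F -> #|X| <= #|x|.
  by rewrite /x; case: arg_maxnP.
have {}xmax X : X \in F -> x \subset X -> X = x.
  by move=> XF xX; apply/esym/eqP; rewrite eqEcard xX xmax.
have cardF : #|F| = #|F :\ x|.+1 by rewrite (cardsD1 x) xF.
pose dn := [set X in F :\ x | X \subset x].
pose nd := [set X in F :\ x | ~~ (X \subset x)].
have dnE X : (X \in dn) = [&& X != x, X \in F & X \subset x].
  by rewrite !inE andbA.
have ndE X : (X \in nd) = (X \in F) && ~~ (X \subset x).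
  by rewrite !inE; have [->|_] := eqVneq X x; rewrite ?subxx /= ?andbF.
have notx X : X \in F -> X != x -> ~~ (x \subset X).
  by move=> XF; apply: contra => xX; rewrite (xmax X XF xX).
have [/cards1P [y Fy]|F'gt1] : #|F :\ x| == 1 \/ 1 < #|F :\ x| by lia.
  have yF : y \in F /\ y != x.
    by have := set11 y; rewrite -Fy !inE => /andP[].
  exists [set y], [set x]; split.
  - by apply/set0Pn; exists y; rewrite inE.
  - by apply/set0Pn; exists x; rewrite inE.
  - by rewrite -Fy setUC setD1K.
  - by rewrite disjoints1 inE; case: yF.
  - case: (boolP (y \subset x)) => yx; [right|left] => A B /set1P-> /set1P-> //.
    by rewrite yx; apply: notx; case: yF.
have sub' := subD1set F x.
have [F1 [F2 [F1n0 F2n0 F12 dis F12s]]] :=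
  IH (F :\ x) ltac:(lia) (N_free_sub sub' NF) F'gt1.
have F'in X : X \in F1 \/ X \in F2 <-> X \in F /\ X != x.
  split; last by case=> XF Xx; apply/orP; rewrite -in_setU F12 !inE Xx.
  by move/orP; rewrite -in_setU F12 !inE => /andP[].
have Fin X : X \in F -> [\/ X = x, X \in F1 | X \in F2].
  move=> XF; case: (eqVneq X x) => [|Xx]; first by constructor 1.
  by case: (proj2 (F'in X)) => //; [constructor 2|constructor 3].
have in1 X : X \in F1 -> X \in F /\ X != x by move=> ?; apply/F'in; left.
have in2 X : X \in F2 -> X \in F /\ X != x by move=> ?; apply/F'in; right.
have finish G : G \subset F :\ x -> G != set0 ->
    parallel G (F :\: G) \/ below G (F :\: G) ->
    exists F1 F2, [/\ F1 != set0, F2 != set0, F1 :|: F2 = F,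
      [disjoint F1 & F2] & parallel F1 F2 \/ below F1 F2].
  move=> GF Gn0 H; exists G, (F :\: G); split => //.
  - apply/set0Pn; exists x; rewrite inE xF andbT.
    by apply/negP => /(subsetP GF); rewrite !inE eqxx.
  - by rewrite setUC setDE setUIl [~: G :|: G]setUC setUCr setIT;
       apply/setUidPl; apply: subset_trans GF sub'.
  - by rewrite disjoint_sym disjoints_subset setDE subsetIr.
have dnsub : dn \subset F :\ x.
  by apply/subsetP => X; rewrite dnE !inE => /and3P[-> ->].
have ndsub : nd \subset F :\ x.
  apply/subsetP => X; rewrite ndE !inE => /andP[-> nX]; rewrite andbT.
  by apply: contra nX => /eqP->.
have dnDE X : (X \in F :\: dn) = (X == x) || (X \in nd).
  rewrite inE dnE ndE; case: (eqVneq X x) => [->|]; first by rewrite xF.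
  by move=> _ /=; case: (X \in F) => //=; rewrite ?andbT ?andbF.
case: F12s => [par|bel].
- (* If [x] is above no member of [F1], then [F1] is still parallel to the rest;
     and likewise for [F2]. *)
  have [/exists_inP[d1 d1F d1x]|n1] := boolP [exists X in F1, X \subset x];
    last first.
    apply: (finish F1) => //; first by rewrite -F12 subsetUl.
    left=> A B A1; rewrite inE => /andP[nB /Fin[->||]] //.
    - rewrite notx ?andbT; try by have [] := in1 _ A1.
      by apply: contra n1 => ?; apply/exists_inP; exists A.
    - by move=> B1; rewrite B1 in nB.
    - exact: par.
  have [/exists_inP[d2 d2F d2x]|n2] := boolP [exists X in F2, X \subset x];
    last first.
    apply: (finish F2) => //; first by rewrite -F12 subsetUr.
    left=> A B A1; rewrite inE => /andP[nB /Fin[->||]] //.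
    - rewrite notx ?andbT; try by have [] := in2 _ A1.
      by apply: contra n2 => ?; apply/exists_inP; exists A.
    - by move=> B1; rewrite andbC; apply: par.
    - by move=> B2; rewrite B2 in nB.
  (* Now [d1] and [d2] are incomparable and below [x].  An [A] of [dn] below a
     [D] of [nd] would make an N with [x] and whichever of [d1], [d2] lies on
     the other side from [A]. *)
  have [d1F' d1nx] := in1 _ d1F; have [d2F' d2nx] := in2 _ d2F.
  have key A D : A \in dn -> D \in nd -> ~~ (A \subset D).
    rewrite dnE ndE => /and3P[Anx AF Ax] /andP[DF Dx]; apply/negP => AD.
    case: (Fin _ AF) => [Axx|A1|A2]; first by rewrite Axx eqxx in Anx.
    - have D1 : D \in F1.
        case: (Fin _ DF) => // [Dxx|D2]; first by rewrite Dxx subxx in Dx.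
        by have /andP[] := par _ _ A1 D2; rewrite AD.
      have := NF d2 A x D d2F' AF xF DF d2x Ax AD.
      have /andP[_ /negPf->] := par _ _ D1 d2F.
      have /andP[/negPf-> _] := par _ _ A1 d2F.
      by rewrite (negPf Dx).
    - have D2 : D \in F2.
        case: (Fin _ DF) => // [Dxx|D1]; first by rewrite Dxx subxx in Dx.
        by have /andP[_] := par _ _ D1 A2; rewrite AD.
      have := NF d1 A x D d1F' AF xF DF d1x Ax AD.
      have /andP[/negPf-> _] := par _ _ d1F D2.
      have /andP[_ /negPf->] := par _ _ d1F A2.
      by rewrite (negPf Dx).
  have [nd0|ndn0] := eqVneq nd set0.
    apply: (finish dn) => //.
      by apply/set0Pn; exists d1; rewrite dnE d1nx d1F'.
    by right=> A B; rewrite dnDE nd0 in_set0 orbF dnE => /and3P[_ _ Ax] /eqP->.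
  apply: (finish nd) => //; left=> D A Dnd; rewrite inE => /andP[And AF].
  have [DF Dx] : D \in F /\ ~~ (D \subset x) by apply/andP; rewrite -ndE.
  have Ax : A \subset x by move: And; rewrite ndE AF /= negbK.
  apply/andP; split; first by apply: contra Dx => /subset_trans; apply.
  have [->|Anx] := eqVneq A x; last by apply: key => //; rewrite dnE Anx AF.
  by apply: notx => //; apply: contra Dx => /eqP->.
- (* If [x] is above all of [F1], it joins [F2].  Otherwise it is above no
     member of [F2], and [dn] is below everything else: for a [B] of [F1] that is
     not below [x], the N to exclude has [B] and [d] under a member [p] of [F2],
     and [d] under [x]. *)
  have [n1|/forall_inPn[a a1 ax]] := boolP [forall X in F1, X \subset x].
    apply: (finish F1) => //; first by rewrite -F12 subsetUl.
    right=> A B A1; rewrite inE => /andP[nB /Fin[->||]] //.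
    - by have /forall_inP := n1; apply.
    - by move=> B1; rewrite B1 in nB.
    - exact: bel.
  have [aF anx] := in1 _ a1.
  have dn1 X : X \in dn -> X \in F1.
    rewrite dnE => /and3P[Xnx XF Xx].
    case: (Fin _ XF) => // [Xxx|X2]; first by rewrite Xxx eqxx in Xnx.
    by move: ax; rewrite (subset_trans (bel _ _ a1 X2) Xx).
  have [dn0|dnn0] := eqVneq dn set0.
    apply: (finish nd) => //; first by apply/set0Pn; exists a; rewrite ndE aF.
    left=> A B; rewrite in_setD !ndE => /andP[AF Ax] /andP[+ BF].
    rewrite BF /= negbK => Bx.
    have -> : B = x.
      by apply/eqP; move: (in_set0 B); rewrite -dn0 dnE BF Bx; case: eqP.
    by rewrite Ax notx //; apply: contra Ax => /eqP->.
  apply: (finish dn) => //; right=> d B ddn; rewrite dnDE.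
  have [dx dF] : d \subset x /\ d \in F by move: ddn; rewrite dnE => /and3P[].
  case/orP=> [/eqP->//|]; rewrite ndE => /andP[BF Bx].
  case: (Fin _ BF) => [->//|B1|B2]; last exact: bel (dn1 _ ddn) B2.
  have /set0Pn[p p2] := F2n0; have [pF pnx] := in2 _ p2.
  have := NF B d p x BF dF pF xF (bel _ _ B1 p2) (bel _ _ (dn1 _ ddn) p2) dx.
  by rewrite (negPf Bx) (negPf (notx _ pF pnx)) orbF.
Qed.

(** * Maximal chains of an N-free family *)
Definition chain F :=
  [forall A in F, forall B in F, (A \subset B) || (B \subset A)].

Lemma chainP F : reflect
  (forall A B, A \in F -> B \in F -> (A \subset B) || (B \subset A)) (chain F).
Proof.
by apply: (iffP forall_inP) => [H A B /H/forall_inP|H A AF]; [apply|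
  apply/forall_inP => B; apply: H].
Qed.

Definition max_chains F :=
  [set C | maxset [pred G : {set {set T}} | (G \subset F) && chain G] C].

Lemma max_chainsP F C : reflect
  [/\ C \subset F, chain C
    & forall G, G \subset F -> chain G -> C \subset G -> G = C]
  (C \in max_chains F).
Proof.
rewrite inE; apply: (iffP maxsetP) => /= [[/andP[CF cC] H]|[CF cC H]]; split=> //.
- by move=> G GF cG; apply: H; rewrite GF.
- by rewrite CF.
- by move=> G /andP[]; apply: H.
Qed.

Lemma chain_sub_max F G : G \subset F -> chain G ->
  exists2 C, C \in max_chains F & G \subset C.
Proof.
move=> GF cG.
pose P := [pred H : {set {set T}} | (H \subset F) && chain H].
have [|C Cmax GC] := @maxset_exists _ P G; first by rewrite /= GF.
by exists C => //; rewrite inE.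
Qed.

Lemma chain_sub F G : G \subset F -> chain F -> chain G.
Proof.
by move=> /subsetP s /chainP H; apply/chainP => A B /s AF /s; apply: H.
Qed.

(** The sets that will encode maximal chains need not belong to the family, but
    they stay between two members.  This is what keeps the codes of parallel
    families apart. *)
Definition spans F q :=
  [exists A in F, A \subset q] && [exists B in F, q \subset B].

Lemma spans_sub F G q : F \subset G -> spans F q -> spans G q.
Proof.
move=> /subsetP FG /andP[/exists_inP[A AF Aq] /exists_inP[B BF qB]].
by apply/andP; split; apply/exists_inP; [exists A|exists B] => //; apply: FG.
Qed.

Lemma max_chain_neq0 F C : F != set0 -> C \in max_chains F -> C != set0.
Proof.
move=> /set0Pn[A AF] /max_chainsP[_ _ H]; apply/eqP => C0.
have := H [set A]; rewrite sub1set AF => /(_ isT); rewrite C0 sub0set.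
have cA : chain [set A] by apply/chainP => ? ? /set1P-> /set1P->; rewrite subxx.
by move=> /(_ cA isT)/setP/(_ A); rewrite !inE eqxx.
Qed.

Lemma max_chains_parallel F G : F != set0 -> parallel F G ->
  max_chains (F :|: G) \subset max_chains F :|: max_chains G.
Proof.
move=> F0 par; apply/subsetP => C CFG; have /max_chainsP[CU cC Cmax] := CFG.
have /set0Pn[A AC] : C != set0.
  by apply: max_chain_neq0 CFG; apply: contra F0; rewrite setU_eq0 => /andP[].
have one (F' G' : {set {set T}}) :
    A \in F' -> parallel F' G' -> C \subset F' :|: G' -> C \subset F'.
  move=> AF p /subsetP s; apply/subsetP => B BC; have /setUP[//|BG] := s _ BC.
  have /andP[/negPf n1 /negPf n2] := p _ _ AF BG.
  by have /chainP/(_ A B AC BC) := cC; rewrite n1 n2.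
rewrite inE; have /setUP[AF|AG] := subsetP CU _ AC; apply/orP; [left|right].
- apply/max_chainsP; split=> //; first exact: one AF par CU.
  by move=> H HF; apply: Cmax; apply: subset_trans HF (subsetUl _ _).
- apply/max_chainsP; split=> //.
    apply: (one _ F AG) => [X Y ? ?|]; first by rewrite andbC; apply: par.
    by rewrite setUC.
  by move=> H HF; apply: Cmax; apply: subset_trans HF (subsetUr _ _).
Qed.

Lemma max_chains_below F G C : below F G -> C \in max_chains (F :|: G) ->
  C :&: F \in max_chains F /\ C :&: G \in max_chains G.
Proof.
move=> bel /max_chainsP[CU cC Cmax].
(* Enlarging [C] inside one layer keeps it a chain. *)
have grow H : H \subset F :|: G -> chain H ->
    (forall A B, A \in H -> B \in C -> (A \subset B) || (B \subset A)) ->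
    H \subset C.
  move=> HU cH HC; rewrite -(Cmax (H :|: C)) ?subsetUl ?subsetUr //.
    by rewrite subUset HU.
  apply/chainP => A B /setUP[AH|AC] /setUP[BH|BC].
  - by move/chainP: cH; apply.
  - exact: HC.
  - by rewrite orbC; apply: HC.
  - by move/chainP: cC; apply.
split; apply/max_chainsP; split; rewrite ?subsetIr //;
  try by apply: chain_sub cC; apply: subsetIl.
- move=> H HF cH CH; apply/eqP; rewrite eqEsubset CH subsetI HF !andbT.
  apply: grow => //; first by apply: subset_trans HF (subsetUl _ _).
  move=> A B AH BC; have /setUP[BF|BG] := subsetP CU _ BC.
    by move/chainP: cH; apply=> //; apply: (subsetP CH); rewrite inE BC.
  by rewrite (bel A B) // (subsetP HF).
- move=> H HG cH CH; apply/eqP; rewrite eqEsubset CH subsetI HG !andbT.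
  apply: grow => //; first by apply: subset_trans HG (subsetUr _ _).
  move=> A B AH BC; have /setUP[BF|BG] := subsetP CU _ BC.
    by rewrite (bel B A) ?orbT // (subsetP HG).
  by move/chainP: cH; apply=> //; apply: (subsetP CH); rewrite inE BC.
Qed.

(** Injective keys for maximal chains, along a series-parallel decomposition.
    In the parallel case, a set spanned by both families would put a member of
    the one below a member of the other, so the two sets of keys are disjoint.
    In the series case, a maximal chain is a maximal chain of [F1] followed by
    one of [F2]; the union [U] of [F1] lies between the keys [q1] of the first
    and [q2] of the second, and [q1 :|: (q2 :\: U)] determines both, as its
    intersection and its union with [U]. *)
Lemma max_chains_keys F : N_free F -> F != set0 ->
  exists2 K : {set {set T}}, #|max_chains F| <= #|K| &
    forall q, q \in K -> spans F q.
Proof.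
elim: {F}#|F| {-2}F (leqnn #|F|) => [|m IH] F leFm NF F0.
  by move: leFm; rewrite leqn0 cards_eq0 (negPf F0).
have [/cards1P[A FA]|F_gt1] : #|F| == 1 \/ 1 < #|F|.
  by move: F0; rewrite -cards_eq0; lia.
  exists [set A]; last first.
    move=> q /set1P->; rewrite /spans FA.
    by apply/andP; split; apply/exists_inP; exists A; rewrite ?inE.
  rewrite cards1 -(cards1 F); apply/subset_leq_card/subsetP => C CF.
  have /set0Pn[B BC] := max_chain_neq0 F0 CF.
  move: CF => /max_chainsP[CF _ _]; rewrite inE eqEsubset CF {1}FA sub1set.
  by have := subsetP CF _ BC; rewrite FA => /set1P <-.
have [F1 [F2 [F1n0 F2n0 F12 dis F12s]]] := N_free_decomposition NF F_gt1.
have cF : #|F| = #|F1| + #|F2|.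
  by rewrite -F12; apply/eqP; rewrite leq_card_setU.
have c1 : 0 < #|F1| by rewrite lt0n cards_eq0.
have c2 : 0 < #|F2| by rewrite lt0n cards_eq0.
have s1 : F1 \subset F by rewrite -F12 subsetUl.
have s2 : F2 \subset F by rewrite -F12 subsetUr.
have [K1 leK1 sK1] := IH F1 ltac:(lia) (N_free_sub s1 NF) F1n0.
have [K2 leK2 sK2] := IH F2 ltac:(lia) (N_free_sub s2 NF) F2n0.
case: F12s => [par|bel].
- exists (K1 :|: K2); last first.
    by move=> q /setUP[/sK1|/sK2]; apply: spans_sub.
  have -> : #|K1 :|: K2| = #|K1| + #|K2|.
    apply/eqP; rewrite leq_card_setU; apply/pred0P => q /=; apply/negP.
    move=> /andP[/sK1/andP[/exists_inP[A A1 Aq] _]].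
    move=> /sK2/andP[_ /exists_inP[B B2 qB]].
    by have /andP[] := par _ _ A1 B2; rewrite (subset_trans Aq qB).
  apply: leq_trans (leq_add leK1 leK2).
  apply: leq_trans (leq_card_setU _ _).1; rewrite -F12.
  exact/subset_leq_card/max_chains_parallel.
- pose U := \bigcup_(A in F1) A.
  have lo q : q \in K1 -> q \subset U.
    move=> /sK1/andP[_ /exists_inP[B B1 qB]].
    exact: subset_trans qB (bigcup_sup _ B1).
  have hi q : q \in K2 -> U \subset q.
    move=> /sK2/andP[/exists_inP[A A2 Aq] _]; apply: subset_trans Aq.
    by apply/bigcupsP => B B1; apply: bel.
  exists [set q.1 :|: (q.2 :\: U) | q in setX K1 K2]; last first.
    move=> _ /imsetP[[q1 q2] /setXP[/= q1K q2K] ->].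
    have /andP[/exists_inP[A A1 Aq] _] := sK1 _ q1K.
    have /andP[_ /exists_inP[B B2 qB]] := sK2 _ q2K.
    apply/andP; split; apply/exists_inP.
      by exists A; [apply: (subsetP s1)|apply: subset_trans Aq (subsetUl _ _)].
    exists B; first exact: (subsetP s2).
    apply: subset_trans qB; rewrite subUset subsetDl andbT.
    exact: subset_trans (lo _ q1K) (hi _ q2K).
  rewrite card_in_imset.
    rewrite cardsX; apply: leq_trans (leq_mul leK1 leK2); rewrite -cardsX.
    rewrite -(@card_in_imset _ _ (fun C => (C :&: F1, C :&: F2)) (max_chains F)).
      apply/subset_leq_card/subsetP => _ /imsetP[C CF ->].
      by apply/setXP; apply: max_chains_below => //; rewrite F12.
    move=> C D /max_chainsP[CF _ _] /max_chainsP[DF _ _] [E1 E2].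
    by rewrite -(setIidPl CF) -(setIidPl DF) -F12 !setIUr E1 E2.
  move=> [p1 p2] [q1 q2] /setXP[/= p1K p2K] /setXP[/= q1K q2K] E.
  have keyI r1 r2 : r1 \in K1 -> (r1 :|: (r2 :\: U)) :&: U = r1.
    move=> /lo/setIidPl r1U; rewrite setIUl r1U setDE -setIA [~: U :&: U]setIC.
    by rewrite setICr setI0 setU0.
  have keyU r1 r2 : r1 \in K1 -> r2 \in K2 -> (r1 :|: (r2 :\: U)) :|: U = r2.
    move=> /lo/setUidPr r1U /hi r2U.
    rewrite -setUA [_ :\: U :|: U]setUC setUA r1U.
    by rewrite setDE setUIr setUCr setIT; apply/setUidPr.
  congr pair; first by rewrite -(keyI p1 p2) // E keyI.
  by rewrite -(keyU p1 p2) // E keyU.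
Qed.

Theorem card_max_chains_N_free F : N_free F -> #|max_chains F| <= 2 ^ #|T|.
Proof.
move=> NF; have [F0|F0] := eqVneq F set0.
  apply: leq_trans (_ : 1 <= _); last by rewrite expn_gt0.
  rewrite -(cards1 (set0 : {set {set T}})); apply/subset_leq_card/subsetP => C.
  by move=> /max_chainsP[+ _ _]; rewrite F0 subset0 inE.
have [K leK _] := max_chains_keys NF F0.
apply: leq_trans leK _; rewrite -cardsT -card_powerset.
by apply: subset_leq_card; rewrite powersetT subsetT.
Qed.
End NFree.

(** * From orderings of the extra points to blue chains *)
Section GreedyChain.
Variables (n k : nat) (blue_set : pred {set 'I_(n + k)}).
Implicit Types (A B : {set 'I_n}) (tau : 'S_k) (Z : {set 'I_(n + k)}).

Definition initial_segment tau i : {set 'I_k} := [set tau j | j : 'I_k & j < i].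

Definition glue A (S : {set 'I_k}) : {set 'I_(n + k)} :=
  (@lshift n k @: A) :|: (@rshift n k @: S).

Lemma mem_glue_l A S x : (lshift k x \in glue A S) = (x \in A).
Proof.
rewrite inE mem_imset; last exact: lshift_inj.
by rewrite orbC; case: imsetP => // -[y _ /eqP]; rewrite eq_lrshift.
Qed.

Lemma mem_glue_r A S y : (rshift n y \in glue A S) = (y \in S).
Proof.
rewrite inE [in X in _ || X]mem_imset; last exact: rshift_inj.
by case: imsetP => // -[x _ /eqP]; rewrite eq_rlshift.
Qed.

Lemma sub_glue A B S S' :
  (glue A S \subset glue B S') = (A \subset B) && (S \subset S').
Proof.
apply/subsetP/andP => [H|[/subsetP AB /subsetP SS] z].
  split; apply/subsetP => x xA.
    by rewrite -(mem_glue_l B S'); apply: H; rewrite mem_glue_l.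
  by rewrite -(mem_glue_r B S'); apply: H; rewrite mem_glue_r.
by case: (split_ordP z) => x ->; rewrite ?mem_glue_l ?mem_glue_r;
  [apply: AB|apply: SS].
Qed.

Lemma initial_segmentS tau i j : i <= j ->
  initial_segment tau i \subset initial_segment tau j.
Proof.
move=> ij; apply/subsetP => _ /imsetP[l li ->]; apply/imset_f.
by rewrite inE (leq_trans _ ij) //; move: li; rewrite inE.
Qed.

Lemma card_initial_segment tau i : i <= k -> #|initial_segment tau i| = i.
Proof.
move=> ik; rewrite card_imset; last exact: perm_inj.
by rewrite cardsE -sum1_card (big_ord_narrow ik) sum1_card card_ord.
Qed.

Lemma mem_initial_segment tau i j : (tau j \in initial_segment tau i) = (j < i).
Proof. by rewrite mem_imset ?inE //; apply: perm_inj. Qed.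

Lemma initial_segments_inj tau tau' :
  (forall i, i <= k -> initial_segment tau i = initial_segment tau' i) ->
  tau = tau'.
Proof.
move=> H; apply/permP => j; pose l := (tau'^-1)%g (tau j).
have E i : i <= k -> (j < i) = (l < i).
  move=> ik; rewrite -(mem_initial_segment tau) H //.
  by rewrite -(mem_initial_segment tau') permKV.
have := E j.+1 (ltn_ord j); have := E j (ltnW (ltn_ord j)).
rewrite ltnn ltnS leqnn.
move=> jl lj; have {2}-> : j = l by apply: val_inj => /=; lia.
by rewrite permKV.
Qed.

(** Below [A] there is an increasing sequence of [i] sets, numbered from 0, such
    that the [j]-th one becomes blue when the first [j] extra points are added
    to it.  A monotone insertion of initial segments that avoids blue sets must
    therefore add at least [i] points to [A]. *)
Fixpoint stuck tau i A :=
  if i is i'.+1 then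
    [exists B : {set 'I_n}, [&& B \subset A, stuck tau i' B
                              & blue_set (glue B (initial_segment tau i'))]]
  else true.

Lemma stuck_subset tau i A B : A \subset B -> stuck tau i A -> stuck tau i B.
Proof.
case: i => // i AB /existsP[C /and3P[CA sC bC]].
by apply/existsP; exists C; rewrite (subset_trans CA AB) sC.
Qed.

Lemma stuck_chain tau i A : stuck tau i A ->
  exists2 C : {set {set 'I_(n + k)}},
    chain C /\ (forall Z, Z \in C ->
      blue_set Z && (Z \subset glue A (initial_segment tau i)))
    & forall j, j < i -> exists B, glue B (initial_segment tau j) \in C.
Proof.
elim: i A => [|i IH] A /=.
  move=> _; exists set0 => //; split; first by apply/chainP => ? ?; rewrite inE.
  by move=> ?; rewrite inE.
case/existsP=> B /and3P[BA /IH[C [/chainP cC CB] Cseg] bB].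
pose Z := glue B (initial_segment tau i); exists (Z |: C).
  split.
    apply/chainP => X Y /setU1P[->|XC] /setU1P[->|YC]; rewrite ?subxx //.
    - by have /andP[_ ->] := CB _ YC; rewrite orbT.
    - by have /andP[_ ->] := CB _ XC.
    - exact: cC.
  have ZA : Z \subset glue A (initial_segment tau i.+1).
    by rewrite sub_glue BA initial_segmentS.
  move=> X /setU1P[->|/CB/andP[-> XZ]]; first by rewrite bB.
  exact: subset_trans XZ ZA.
move=> j; rewrite ltnS leq_eqVlt => /orP[/eqP->|/Cseg[D DC]].
  by exists B; rewrite setU11.
by exists D; rewrite inE DC orbT.
Qed.

(** Adding to each [A] the largest number [l A] of points for which it is stuck
    is monotone in [A], and gives a red set: a blue one would extend the
    sequence that witnesses [stuck tau (l A) A]. *)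
Lemma red_cube_of_not_stuck tau : ~~ stuck tau k.+1 setT ->
  exists f : {set 'I_n} -> {set 'I_(n + k)},
    (forall A B, (f A \subset f B) = (A \subset B)) /\
    forall A, ~~ blue_set (f A).
Proof.
move=> nst; pose l A := \max_(i < k.+1 | stuck tau i A) i.
have le_l i A : i < k.+1 -> stuck tau i A -> i <= l A.
  move=> ik; exact: (@leq_bigmax_cond _ _ (fun i : 'I_k.+1 => i : nat) (Ordinal ik)).
exists (fun A => glue A (initial_segment tau (l A))); split.
  move=> A B; rewrite sub_glue; case: (boolP (A \subset B)) => // AB.
  apply: initial_segmentS; apply/bigmax_leqP => i iA.
  by apply: le_l => //; apply: stuck_subset iA.
move=> A; apply/negP => bA.
have [|i0 si0 lE] :=
    @eq_bigmax_cond _ [pred i : 'I_k.+1 | stuck tau i A] (fun i => i : nat).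
  by apply/card_gt0P; exists ord0.
have sl : stuck tau (l A).+1 A.
  apply/existsP; exists A; rewrite subxx bA andbT /=.
  by have -> : l A = i0 by []; rewrite inE in si0.
have [lk|kl] := ltnP (l A) k.
  by have := le_l (l A).+1 A lk sl; rewrite ltnn.
have lE' : l A = k.
  by apply/eqP; rewrite eqn_leq kl andbT; apply/bigmax_leqP => i _; rewrite -ltnS.
by move: nst; rewrite -lE' (stuck_subset (subsetT A) sl).
Qed.

(** Two members of a chain whose traces on the extra points have the same size
    have the same trace; so a chain cannot contain sets for all the initial
    segments of two different orderings. *)
Lemma fact_leq_max_chains (F := [set Z | blue_set Z]) :
  (forall tau, stuck tau k.+1 setT) -> k`! <= #|max_chains F|.
Proof.
move=> st.
have ex tau : exists C, (C \in max_chains F) &&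
    [forall i : 'I_k.+1, exists B, glue B (initial_segment tau i) \in C].
  have [C [cC CB] Cseg] := stuck_chain (st tau).
  have CF : C \subset F by apply/subsetP => Z /CB/andP[bZ _]; rewrite inE.
  have [D DF CD] := chain_sub_max CF cC; exists D; rewrite DF.
  apply/forallP => i; have [B BC] := Cseg i (ltn_ord i).
  by apply/existsP; exists B; apply: (subsetP CD).
pose M tau := xchoose (ex tau).
have MP tau : M tau \in max_chains F /\
    forall i, i <= k -> exists B, glue B (initial_segment tau i) \in M tau.
  have /andP[? /forallP H] := xchooseP (ex tau); split=> // i ik.
  exact/existsP/(H (Ordinal (ik : i < k.+1))).
rewrite -(card_Sn k) -(@card_imset _ _ M).
  by apply/subset_leq_card/subsetP => _ /imsetP[tau _ ->]; have [] := MP tau.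
move=> tau tau' E; apply: initial_segments_inj => i ik.
have [Mc H] := MP tau; have [B BM] := H i ik.
have [_ H'] := MP tau'; have [B' BM'] := H' i ik; rewrite -E in BM'.
have /max_chainsP[_ /chainP cM _] := Mc.
have := cM _ _ BM BM'; rewrite !sub_glue => /orP[]/andP[_ S];
  [|symmetry]; apply/eqP; by rewrite eqEcard S !card_initial_segment ?leqnn.
Qed.

Theorem red_cube_of_N_free (F := [set Z | blue_set Z]) :
  N_free F -> 2 ^ (n + k) < k`! ->
  exists f : {set 'I_n} -> {set 'I_(n + k)},
    (forall A B, (f A \subset f B) = (A \subset B)) /\
    forall A, ~~ blue_set (f A).
Proof.
move=> NF lt; have [/forallP st|] := boolP [forall tau, stuck tau k.+1 setT].
  have := leq_trans (fact_leq_max_chains st) (card_max_chains_N_free NF).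
  by rewrite card_ord leqNgt lt.
by rewrite negb_forall => /existsP[tau /red_cube_of_not_stuck].
Qed.
End GreedyChain.

(** * Copies of Boolean lattices and a Reed-Solomon code *)
Lemma card_powerset_type (T : finType) : #|{set T}| = 2 ^ #|T|.
Proof.
by rewrite -(cardsT T) -card_powerset; apply: eq_card => A; rewrite powersetT !inE.
Qed.

Lemma subset_mono_inj (U V : finType) (f : {set U} -> {set V}) :
  (forall A B, (f A \subset f B) = (A \subset B)) -> injective f.
Proof. by move=> fE A B E; apply/eqP; rewrite eqEsubset -!fE E subxx. Qed.

(** Take for [x i] a point of [f [set i]] outside [f (~: [set i])]. *)
Lemma embedding_coordinates (n : nat) (U : finType) (f : {set 'I_n} -> {set U}) :
  (forall A B, (f A \subset f B) = (A \subset B)) ->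
  exists2 x : 'I_n -> U, injective x & forall i A, (x i \in f A) = (i \in A).
Proof.
move=> fE; have ex i : exists x, (x \in f [set i]) && (x \notin f (~: [set i])).
  have : ~~ (f [set i] \subset f (~: [set i])).
    by rewrite fE sub1set !inE eqxx.
  by case/subsetPn => x xi xni; exists x; rewrite xi.
pose x i := xchoose (ex i).
have xE i A : (x i \in f A) = (i \in A).
  have /andP[xi xni] := xchooseP (ex i); apply/idP/idP => [xA|iA].
    apply: contraR xni => iA; apply: subsetP xA; rewrite fE.
    by apply/subsetP => j jA; rewrite !inE; apply: contra iA => /eqP <-.
  by apply: subsetP xi; rewrite fE sub1set.
exists x => // i j ij.
by have := xE i [set j]; rewrite ij xE !inE eqxx => /esym/eqP.
Qed.

Lemma injection_of_card (A B : finType) : #|A| <= #|B| ->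
  exists f : A -> B, injective f.
Proof.
move=> AB; exists (fun x => enum_val (widen_ord AB (enum_rank x))) => x y.
by move/enum_val_inj/(congr1 val) => /= /val_inj/enum_rank_inj.
Qed.

Section RootCode.
Variables (F : fieldType) (U J : finType) (e : U -> F) (pt : J -> F).
Hypotheses (e_inj : injective e) (pt_inj : injective pt).
Implicit Type Y : {set U}.
Local Open Scope ring_scope.

Definition locator Y : {poly F} :=
  \prod_(a <- [seq e y | y <- enum Y]) ('X - a%:P).

(** A Reed-Solomon codeword, with one coordinate for each [j]. *)
Definition root_code Y j : F := (locator Y).[pt j].

(** The locators of [Y] and [Y'] differ because their roots do, and their
    difference, of degree at most [k], has at most [k] roots. *)
Lemma root_code_agreement Y Y' k : #|Y| = k -> #|Y'| = k -> Y != Y' ->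
  (#|[set j | root_code Y j == root_code Y' j]| <= k)%N.
Proof.
move=> Yk Y'k neq; set E := [set j | _].
have szl (Z : {set U}) : #|Z| = k -> size (locator Z) = k.+1.
  by move=> Zk; rewrite /locator size_prod_XsubC size_map -cardE Zk.
have rootl (Z : {set U}) y : root (locator Z) (e y) = (y \in Z).
  by rewrite /locator root_prod_XsubC mem_map // mem_enum.
have nz : locator Y - locator Y' != 0.
  rewrite subr_eq0; apply: contra neq => /eqP E'; apply/eqP/setP => y.
  by rewrite -!rootl E'.
have := @max_poly_roots _ _ [seq pt j | j <- enum E] nz.
rewrite size_map -cardE map_inj_uniq // enum_uniq => lt.
rewrite -ltnS; apply: leq_trans (lt _ isT) _.
  apply/allP => _ /mapP[j + ->]; rewrite mem_enum inE => /eqP jE.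
  by rewrite rootE hornerD hornerN subr_eq0; apply/eqP.
by apply: leq_trans (size_polyD _ _) _; rewrite size_polyN !szl // maxnn.
Qed.
End RootCode.

Lemma prefix_onth (T : eqType) (s s' : seq T) :
  (forall i x, onth s i = Some x -> onth s' i = Some x) -> prefix s s'.
Proof.
elim: s s' => [|x s IH] [|y s'] H //=; first by have := H 0 x erefl.
have [->] := H 0 x erefl; rewrite eqxx IH // => i; exact: (H i.+1).
Qed.

Lemma prefix_total (T : eqType) (s s' r : seq T) :
  prefix s r -> prefix s' r -> prefix s s' || prefix s' s.
Proof.
elim: r s s' => [|z r IH] [|x s] [|y s'] //= /andP[/eqP-> sr] /andP[/eqP-> s'r].
by rewrite eqxx; apply: IH.
Qed.

(** * Shrubs *)
Section Shrubs.
(* Blocks are indexed by [inl j] for the codewords of the [k]-sets and by [inr c]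
   for the sequences.  In block [b], the symbol [s] is stored by choosing one of
   the two points [slot (b, i, true)] and [slot (b, i, false)] for each bit [i]:
   thus the sets that store two different symbols are incomparable. *)
Variables (U Sym : finType) (k t : nat).
Variables (bits : Sym -> {set 'I_t}) (e : U -> Sym).
Variable slot : ('I_(3 * k).+1 + 'I_(2 * k)) * 'I_t * bool -> U.
Variable root_symbol : {set U} -> 'I_(3 * k).+1 -> Sym.
Hypotheses (t_gt0 : 0 < t) (bits_inj : injective bits) (e_inj : injective e).
Hypothesis slot_inj : injective slot.
Hypothesis root_symbol_agreement : forall Y Y' : {set U}, #|Y| = k -> #|Y'| = k ->
  Y != Y' -> #|[set j | root_symbol Y j == root_symbol Y' j]| <= k.
Implicit Types (Y Z : {set U}) (S : seq U).

Definition touched Y :=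
  [set b | [exists i, exists v, slot (b, i, v) \in Y]].

(** The map [h] serves to count the blocks of each of the two kinds. *)
Lemma card_touched (B : finType) (h : B -> 'I_(3 * k).+1 + 'I_(2 * k)) Y :
  injective h -> #|[set b | h b \in touched Y]| <= #|Y|.
Proof.
move=> h_inj; set D := [set b | _].
have wit b : exists y, (b \in D) ==>
    (y \in Y) && [exists i, exists v, y == slot (h b, i, v)].
  case: (boolP (b \in D)) => [|_].
    2: by exists (slot (h b, Ordinal t_gt0, true)).
  rewrite !inE => /existsP[i /existsP[v svY]]; exists (slot (h b, i, v)).
  by rewrite svY; apply/existsP; exists i; apply/existsP; exists v.
pose w b := xchoose (wit b).
have wP b : b \in D -> w b \in Y /\ exists i v, w b = slot (h b, i, v).
  move=> bD; have /implyP/(_ bD)/andP[wY] := xchooseP (wit b).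
  by case/existsP=> i /existsP[v /eqP E]; split=> //; exists i, v.
rewrite -(@card_in_imset _ _ w).
  by apply/subset_leq_card/subsetP => _ /imsetP[b /wP[? _] ->].
move=> b c /wP[_ [i [v bE]]] /wP[_ [i' [v' cE]]] E.
by move: bE; rewrite E cE => /slot_inj[/h_inj ->].
Qed.

Definition untouched Y := enum [set c : 'I_(2 * k) | inr c \notin touched Y].

Lemma size_untouched Y : #|Y| = k -> k <= size (untouched Y).
Proof.
move=> Yk; pose D := [set c : 'I_(2 * k) | inr c \in touched Y].
have leD : #|D| <= #|Y| by apply: card_touched; apply: inr_inj.
have := cardsC D; rewrite card_ord /untouched -cardE.
have -> : [set c | inr c \notin touched Y] = ~: D.
  by apply/setP => c; rewrite !inE.
by rewrite Yk in leD; lia.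
Qed.

(** The symbol stored in block [b] by the node of [S], provided that [Y] does not
    meet that block: the [i]-th point of [S] goes to the [i]-th untouched block
    of the second kind, and the blocks after the end of [S] remain empty. *)
Definition content Y S (b : 'I_(3 * k).+1 + 'I_(2 * k)) : option Sym :=
  match b with
  | inl a => Some (root_symbol Y a)
  | inr c => omap e (onth S (index c (untouched Y)))
  end.

Definition marked Y S (p : ('I_(3 * k).+1 + 'I_(2 * k)) * 'I_t * bool) :=
  let: (b, i, v) := p in
  (b \notin touched Y) &&
  (if content Y S b is Some s then v == (i \in bits s) else false).

Definition node Y S : {set U} :=
  [set x in S] :|: [set slot p | p in marked Y S].

Lemma mem_node Y S x : x \in Y -> (x \in node Y S) = (x \in S).
Proof.
move=> xY; rewrite !inE; case: imsetP => [[[[b i] v] + xE]|]; last by rewrite orbF.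
move=> /andP[+ _]; rewrite inE => /existsPn/(_ i)/existsPn/(_ v).
by rewrite -xE xY.
Qed.

Lemma slot_node Y S b i v : {subset S <= Y} -> b \notin touched Y ->
  (slot (b, i, v) \in node Y S) =
  (if content Y S b is Some s then v == (i \in bits s) else false).
Proof.
move=> SY nt; rewrite !inE mem_imset // unfold_in /= nt /=.
suff -> : (slot (b, i, v) \in S) = false by [].
apply/negP => /SY sY; move: nt; rewrite inE => /existsPn/(_ i)/existsPn/(_ v).
by rewrite sY.
Qed.

Lemma node_prefix Y S S' : prefix S S' -> node Y S \subset node Y S'.
Proof.
case/prefixP => R ->; apply/subsetP => x; rewrite !inE => /orP[xS|].
  by rewrite mem_cat xS.
case/imsetP => [[[b i] v]] /andP[nt cb] ->.
rewrite orbC imset_f // unfold_in /= nt /=; case: b cb {nt} => //= c.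
case E: (onth S _) => [y|//] /=.
have iS : index c (untouched Y) < size S by rewrite -onthTE E.
by rewrite onth_cat iS E.
Qed.

(** For different [Y] and [Y'], at most [k] blocks of the first kind are touched
    by [Y], at most [k] by [Y'], and at most [k] store the same symbol in both
    shrubs, which leaves one of the [3 * k + 1] blocks to separate the nodes.
    For [Y = Y'], the blocks of the second kind are compared one by one. *)
Lemma node_subset Y Y' S S' : #|Y| = k -> #|Y'| = k ->
  uniq S -> {subset S <= Y} -> {subset S' <= Y'} ->
  node Y S \subset node Y' S' -> Y = Y' /\ prefix S S'.
Proof.
move=> Yk Y'k uS SY SY' /subsetP sub.
have cmp b s : b \notin touched Y -> b \notin touched Y' ->
    content Y S b = Some s -> content Y' S' b = Some s.
  move=> nt nt' cb.
  have sl i : slot (b, i, i \in bits s) \in node Y' S'.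
    by apply: sub; rewrite slot_node // cb.
  case cb': (content Y' S' b) => [s'|]; last first.
    by have := sl (Ordinal t_gt0); rewrite slot_node // cb'.
  congr Some; apply: bits_inj; apply/setP => i.
  by have := sl i; rewrite slot_node // cb' => /eqP.
have EY : Y = Y'.
  apply/eqP; apply: contraT => neq.
  have A1 := root_symbol_agreement Yk Y'k neq.
  have A2 := card_touched Y (@inl_inj 'I_(3 * k).+1 'I_(2 * k)).
  have A3 := card_touched Y' (@inl_inj 'I_(3 * k).+1 'I_(2 * k)).
  set E1 := [set j | _] in A1; set E2 := [set b | _] in A2.
  set E3 := [set b | _] in A3.
  have : #|E1 :|: E2 :|: E3| < #|[set: 'I_(3 * k).+1]|.
    have := leq_card_setU E1 E2; have := leq_card_setU (E1 :|: E2) E3.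
    by rewrite cardsT card_ord => -[? _] [? _]; lia.
  rewrite ltnNge; apply: contraNT => _; apply/subset_leq_card/subsetP => j _.
  apply/negPn/negP; rewrite !in_setU !negb_or => /andP[/andP[n1 n2] n3].
  rewrite in_set in n1; rewrite in_set in n2; rewrite in_set in n3.
  by have := cmp (inl j) _ n2 n3 erefl => /= -[] /eqP; rewrite eq_sym (negPf n1).
split=> //; subst Y'.
have Sk : size S <= k.
  by rewrite -Yk -(card_uniqP uS); apply/subset_leq_card/subsetP.
apply: prefix_onth => i y Si.
have iS : i < size S by rewrite -onthTE Si.
have iu : i < size (untouched Y).
  by apply: leq_trans iS (leq_trans Sk (size_untouched Yk)).
have c0 : 'I_(2 * k) by case: (untouched Y) iu.
pose c := nth c0 (untouched Y) i.
have ci : index c (untouched Y) = i.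
  by rewrite index_uniq // enum_uniq.
have nt : inr c \notin touched Y.
  by have := mem_nth c0 iu; rewrite mem_enum inE.
have := cmp (inr c) (e y) nt nt; rewrite /= ci Si => /(_ erefl).
by case: (onth S' i) => //= z [/e_inj ->].
Qed.

Definition is_node Z := exists Y S,
  [/\ #|Y| = k, uniq S, {subset S <= Y} & Z = node Y S].

Lemma nodes_below_chain A B C : is_node A -> is_node B -> is_node C ->
  A \subset C -> B \subset C -> (A \subset B) || (B \subset A).
Proof.
move=> [Y [S [Yk uS SY ->]]] [Y' [S' [Yk' uS' SY' ->]]].
move=> [Y'' [S'' [Yk'' uS'' SY'' ->]]].
move=> /node_subset[]// EY pS /node_subset[]// EY' pS'; subst Y'' Y'.
by have /orP[/node_prefix->|/node_prefix->] := prefix_total pS pS'; rewrite ?orbT.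
Qed.

(** Let [Y] be the complement of the coordinates of the copy [f], and start at
    the root of the shrub of [Y].  At the node of [S], apply [f] to the trace
    [A S] of that node on the coordinates.  The image agrees with the node
    outside [Y] and contains [S].  Either it is the node, or it contains some new
    point of [Y], with which [S] is extended; this enlarges the trace and its
    image.  After [k] steps [S] exhausts [Y]. *)
Lemma node_in_every_cube n (f : {set 'I_n} -> {set U}) : n + k = #|U| ->
  (forall A B, (f A \subset f B) = (A \subset B)) -> exists A, is_node (f A).
Proof.
move=> nkU fE; have [x x_inj xE] := embedding_coordinates fE.
pose Y := ~: [set x i | i : 'I_n].
have Yk : #|Y| = k.
  have := cardsC [set x i | i : 'I_n]; rewrite -/Y card_imset // card_ord -nkU.
  by move/addnI.
pose A S := [set i | x i \in node Y S].
have fA S z : z \notin Y -> (z \in f (A S)) = (z \in node Y S).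
  by rewrite inE negbK => /imsetP[i _ ->]; rewrite xE inE.
have hit S : {subset S <= f (A S)} -> f (A S) :&: Y \subset S ->
    f (A S) = node Y S.
  move=> Sf sub; apply/setP => z.
  have [zY|zY] := boolP (z \in Y); last exact: fA.
  rewrite mem_node //; apply/idP/idP; last exact: Sf.
  by move=> zf; apply: (subsetP sub); rewrite inE zf.
suff walk d S : size S + d = k -> uniq S -> {subset S <= Y} ->
    {subset S <= f (A S)} -> exists A, is_node (f A).
  by apply: (walk k [::]).
elim: d S => [|d IH] S Sd uS SY Sf;
  have [sub|] := boolP (f (A S) :&: Y \subset S).
- by exists (A S), Y, S; split=> //; apply: hit.
- case/subsetPn => z; rewrite inE => /andP[_ zY] /negP[].
  suff /setP/(_ z) : [set x in S] = Y by rewrite inE zY.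
  apply/eqP; rewrite eqEcard Yk -Sd addn0 cardsE (card_uniqP uS) leqnn andbT.
  by apply/subsetP => y; rewrite inE; apply: SY.
- by exists (A S), Y, S; split=> //; apply: hit.
- case/subsetPn => y; rewrite inE => /andP[yf yY] yS.
  have AS : f (A S) \subset f (A (rcons S y)).
    rewrite fE; apply/subsetP => i; rewrite in_set => xi; rewrite in_set.
    exact: (subsetP (node_prefix Y (prefix_rcons S y))).
  apply: (IH (rcons S y)).
  + by rewrite size_rcons addSnnS.
  + by rewrite rcons_uniq yS.
  + by move=> z; rewrite mem_rcons inE => /orP[/eqP->|/SY].
  + by move=> z; rewrite mem_rcons inE => /orP[/eqP->|/Sf]; apply: (subsetP AS).
Qed.
End Shrubs.

(** * Ramsey arrows *)
Lemma boolean_lattice_leE n (A B : boolean_lattice n) :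
  (A <= B)%O = ((A : {set 'I_n}) \subset (B : {set 'I_n})).
Proof. exact: preorder.Order.SetSubsetOrder.leEsubset. Qed.

Definition blue n (c : boolean_lattice n -> color) (Z : {set 'I_n}) : bool :=
  if c Z is Blue then true else false.

Lemma blueP n (c : boolean_lattice n -> color) Z :
  reflect (c Z = Blue) (blue c Z).
Proof. by rewrite /blue; case: (c Z); constructor. Qed.

Lemma not_blueP n (c : boolean_lattice n -> color) Z :
  reflect (c Z = Red) (~~ blue c Z).
Proof. by rewrite /blue; case: (c Z); constructor. Qed.

Lemma red_cubeP n N (c : boolean_lattice N -> color) :
  (exists2 S, is_copy (boolean_lattice n) S & monochromatic c Red S) <->
  exists f : {set 'I_n} -> {set 'I_N},
    (forall A B, (f A \subset f B) = (A \subset B)) /\ forall A, ~~ blue c (f A).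
Proof.
split=> [[_ [f [_ fE] ->] fR]|[f [fE fR]]].
  exists f; split=> [A B|A]; first by rewrite -!boolean_lattice_leE fE.
  by apply/not_blueP/fR; exists A.
exists (range (f : boolean_lattice n -> boolean_lattice N)).
  exists f => //; split=> [|A B]; last by rewrite !boolean_lattice_leE fE.
  exact: subset_mono_inj fE.
by move=> _ [A _ <-]; apply/not_blueP.
Qed.

Lemma blue_NP N (c : boolean_lattice N -> color) :
  (exists2 S, is_copy N_poset S & monochromatic c Blue S) <->
  ~ N_free [set Z | blue c Z].
Proof.
split=> [[_ [f [_ fE] ->] fB] NF|nNF].
  have bf x : f x \in [set Z | blue c Z].
    by rewrite inE; apply/blueP/fB; exists x.
  have := NF _ _ _ _ (bf NA) (bf NB) (bf NC) (bf ND).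
  by rewrite -!boolean_lattice_leE !fE => /(_ isT isT isT).
apply: contrapT => noN; apply: nNF => A B C D.
rewrite !inE => /blueP bA /blueP bB /blueP bC /blueP bD AC BC BD.
apply: contrapT => /negP; rewrite !negb_or => /and3P[nAD nBA nDC]; apply: noN.
pose f x : boolean_lattice N :=
  match x with NA => A | NB => B | NC => C | ND => D end.
exists (range f); last by move=> _ [[] _ <-].
exists f => //.
have nAB : ~~ (A \subset B).
  by apply: contra nAD => AB; apply: subset_trans AB BD.
have nCA : ~~ (C \subset A) by apply: contra nBA; apply: subset_trans.
have nCD : ~~ (C \subset D) by apply: contra nAD; apply: subset_trans.
have nCB : ~~ (C \subset B) by apply: contra nAB; apply: subset_trans.
have nDB : ~~ (D \subset B).
  by apply: contra nDC => DB; apply: subset_trans DB BC.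
have nDA : ~~ (D \subset A) by apply: contra nBA; apply: subset_trans.
have fE : {mono f : x y / (x <= y)%O}.
  by move=> x y; rewrite boolean_lattice_leE; case: x; case: y => /=;
     rewrite ?subxx ?AC ?BC ?BD //; apply/negbTE.
by split=> // x y E; apply: le_anti; rewrite -!fE E lexx.
Qed.

Lemma arrow_of_fact n k : 2 ^ (n + k) < k`! ->
  ramsey_arrow N_poset (boolean_lattice n) (n + k).
Proof.
move=> lt c; have [NF|NF] := pselect (N_free [set Z | blue c Z]).
  by right; apply/red_cubeP; apply: red_cube_of_N_free NF lt.
by left; apply/blue_NP.
Qed.

Lemma not_arrow_small n M : M < n -> ~ ramsey_arrow N_poset (boolean_lattice n) M.
Proof.
move=> Mn /(_ (fun=> Red))[[_ [f _ ->] fB]|/red_cubeP[f [fE _]]].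
  by have /fB : range f (f NA) by exists NA.
have /leq_card := subset_mono_inj fE.
by rewrite !card_powerset_type !card_ord leq_exp2l // leqNgt Mn.
Qed.

Lemma not_arrow_shrubs n k t : 0 < t -> n + k <= 2 ^ t ->
  (5 * k).+1 * (2 * t) <= n + k ->
  ~ ramsey_arrow N_poset (boolean_lattice n) (n + k).
Proof.
move=> t_gt0 le_e le_slot arrow.
have [F _ cardF] := pPrimePowerField (isT : prime 2) t_gt0.
have [e e_inj] : exists e : 'I_(n + k) -> F, injective e.
  by apply: injection_of_card; rewrite card_ord cardF.
have [pt pt_inj] : exists e : 'I_(3 * k).+1 -> F, injective e.
  by apply: injection_of_card; rewrite card_ord cardF; nia.
have [bits bits_inj] : exists bits : F -> {set 'I_t}, injective bits.
  by apply: injection_of_card; rewrite cardF card_powerset_type card_ord.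
have [slot slot_inj] :
    exists slot : ('I_(3 * k).+1 + 'I_(2 * k)) * 'I_t * bool -> 'I_(n + k),
    injective slot.
  apply: injection_of_card.
  by rewrite !card_prod card_sum !card_ord card_bool; nia.
pose nodes := is_node bits e slot (root_code e pt).
pose c Z := if `[< nodes Z >] then Blue else Red.
have [Hblue|/red_cubeP[f [fE fR]]] := arrow c.
  case/blue_NP: Hblue => A B C D.
  have nodeE Z : Z \in [set Z | blue c Z] -> nodes Z.
    by rewrite inE /blue /c; case: asboolP.
  move=> /nodeE An /nodeE Bn /nodeE Cn _ AC BC BD.
  have /orP[AB|->] := nodes_below_chain t_gt0 bits_inj e_inj slot_inj
    (fun Y Y' => @root_code_agreement _ _ _ e pt e_inj pt_inj Y Y' k)
    An Bn Cn AC BC.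
    by rewrite (subset_trans AB BD).
  by rewrite orbT.
have [|A An] := node_in_every_cube bits e slot (root_code e pt) _ fE.
  by rewrite card_ord.
by have := fR A; rewrite /blue /c; case: asboolP.
Qed.

(** * Asymptotics *)
(** Each of the [k] factors of [(2 * k) ^_ k = 'C(2 * k, k) * k`!] is at least
    [k]. *)
Lemma expn_self_leq_fact k : k ^ k <= 4 ^ k * k`!.
Proof.
have bin_le m : 'C(m, k) <= 2 ^ m.
  by rewrite -(card_ord m) -card_draws -card_powerset_type max_card.
have -> : 4 ^ k = 2 ^ (2 * k) by rewrite (expnM 2 2).
apply: leq_trans (leq_mul (bin_le (2 * k)) (leqnn _)).
rewrite bin_ffact ffact_prod -[X in _ ^ X]card_ord -prod_nat_const.
by apply: leq_prod => i _; have := ltn_ord i; lia.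
Qed.

Lemma exp2_lt_fact n k : 2 ^ (n + 3 * k) < k ^ k -> 2 ^ (n + k) < k`!.
Proof.
move=> lt; have := leq_trans lt (expn_self_leq_fact k).
have -> : 2 ^ (n + 3 * k) = 4 ^ k * 2 ^ (n + k).
  have -> : 4 ^ k = 2 ^ (2 * k) by rewrite (expnM 2 2).
  by rewrite -expnD; congr (2 ^ _); lia.
by rewrite ltn_pmul2l // expn_gt0.
Qed.

Local Open Scope classical_set_scope.
Local Open Scope ring_scope.

Lemma poset_ramseyP (d d' : Order.disp_t) (P : porderType d) (Q : porderType d') N :
  (0 < N)%N -> ramsey_arrow P Q N -> is_poset_ramsey P Q (poset_ramsey P Q).
Proof.
move=> N0 arrow; apply: (@xgetPex _ 0%N [set N | is_poset_ramsey P Q N]).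
have ex : exists N, `[< (0 < N)%N /\ ramsey_arrow P Q N >].
  by exists N; apply/asboolP.
have [M /asboolP[M0 Marrow] Mmin] := ex_minnP ex.
exists M; split=> // M' M'0 M'arrow.
by apply: Mmin; apply/asboolP.
Qed.

Section Asymptotics.
Variable R : realType.
Implicit Types (c x y : R) (n k : nat).

Lemma ln2_bounds : 1 / 2 <= ln 2 :> R /\ ln 2 <= 1 :> R.
Proof.
split; last first.
  have := @le_ln1Dx R 1; by rewrite -[1 + 1]/(2 : R); apply; lra.
have : ln (2^-1 : R) <= - (1/2).
  have := @le_ln1Dx R (- (1/2)).
  have -> : 1 + - (1 / 2) = 2^-1 :> R by lra.
  by apply; lra.
rewrite lnV ?posrE //; lra.
Qed.

Lemma ln_sublinear c K :
  0 < c -> exists M : R, forall y, M <= y -> ln y + K <= c * y.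
Proof.
move=> c0; exists (Num.max 1 (2 / c * (K - ln (c / 2)))) => y.
rewrite ge_max => /andP[y1 yM]; have y0 : 0 < y by lra.
have cy : 0 < c / 2 * y by rewrite mulr_gt0 // divr_gt0.
have := @le_ln1Dx R (c / 2 * y - 1).
have -> : 1 + (c / 2 * y - 1) = c / 2 * y by lra.
rewrite lnM ?posrE ?divr_gt0 // => /(_ ltac:(lra)) H.
suff : K - ln (c / 2) <= c / 2 * y by lra.
have := ler_wpM2l (_ : 0 <= c / 2) yM; rewrite mulrA.
have -> : c / 2 * (2 / c) = 1 by field; lra.
rewrite mul1r; apply; lra.
Qed.

Lemma near_ln_sublinear c K : 0 < c ->
  \forall n \near \oo, ln (n%:R : R) + K <= c * n%:R.
Proof.
move=> c0; have [M HM] := ln_sublinear K c0.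
by near=> n; apply: HM; near: n; apply: nbhs_infty_ger.
Unshelve. all: by end_near. Qed.

Lemma near_ln_ge M : \forall n \near \oo, M <= ln (n%:R : R).
Proof.
near=> n; have nM : expR M <= n%:R by near: n; apply: nbhs_infty_ger.
by rewrite -(expRK M) ler_ln ?posrE ?expR_gt0 // (lt_le_trans _ nM) ?expR_gt0.
Unshelve. all: by end_near. Qed.

(** As [k`! >= (k / 4) ^ k], it suffices that [k * (log2 k - 3) > n].  For [k]
    just above [(1 + e / 2) * n / log2 n], the factor [log2 k - 3] is
    [(1 - o(1)) * log2 n], and rounding [k] up costs less than
    [(e / 2) * n / log2 n]. *)
Lemma near_fact_gt (e : R) : 0 < e -> \forall n \near \oo,
  exists2 k, (2 ^ (n + k) < k`!)%N & k%:R <= (1 + e) * n%:R / log2 (n%:R : R).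
Proof.
move=> e0; pose d := e / 2; have d0 : 0 < d by rewrite divr_gt0.
have [ln2l ln2u] := ln2_bounds.
have c0 : 0 < d / (1 + d) by rewrite divr_gt0 //; lra.
have [M HM] := ln_sublinear (4 * ln 2) c0.
near=> n.
pose l := ln (n%:R : R).
have n1 : 1 <= n%:R :> R by near: n; apply: nbhs_infty_ger.
have lM : M <= l by rewrite /l; near: n; apply: near_ln_ge.
have l1 : 1 <= l by rewrite /l; near: n; apply: near_ln_ge.
have ln_small : l + 0 <= d * ln 2 * n%:R.
  by rewrite /l; near: n; apply: near_ln_sublinear; rewrite mulr_gt0 //; lra.
pose x := (1 + d) * n%:R * ln 2 / l.
have x0 : 0 < x by rewrite divr_gt0 ?mulr_gt0 //; lra.
pose k := (Num.truncn x).+1.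
have xk : x < k%:R by rewrite /k truncnS_gt.
have kx : k%:R <= x + 1.
  by rewrite /k -natr1 lerD2r truncn_le ltW.
exists k; last first.
  apply: le_trans kx _; rewrite /log2 -/l.
  have -> : (1 + e) * n%:R / (l / ln 2) = x + d * n%:R * ln 2 / l.
    by rewrite /x /d; field; apply/andP; split; lra.
  rewrite lerD2l ler_pdivlMr; lra.
have k0 : 0 < k%:R :> R by lra.
have lnk : l - ln l - ln 2 <= ln (k%:R : R).
  apply: (@le_trans _ _ (ln x)); last by rewrite ler_ln ?posrE //; lra.
  have -> : l - ln l - ln 2 = ln (n%:R / 2 / l).
    by rewrite !ln_div ?posrE ?divr_gt0 -/l; lra.
  rewrite ler_ln ?posrE //; last by rewrite !divr_gt0 //; lra.
  rewrite /x ler_pM2r ?invr_gt0; last lra.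
  nra.
have main : (n%:R + 3 * k%:R) * ln 2 < k%:R * ln (k%:R : R).
  suff : n%:R * ln 2 < k%:R * (l - ln l - 4 * ln 2) by nra.
  have HMl := HM l lM.
  have q0 : 0 < l / (1 + d) by rewrite divr_gt0 //; lra.
  have B : l / (1 + d) <= l - ln l - 4 * ln 2.
    have : l / (1 + d) = l - d / (1 + d) * l by field; lra.
    lra.
  apply: (@lt_le_trans _ _ (k%:R * (l / (1 + d)))).
    2: by rewrite ler_pM2l.
  have -> : n%:R * ln 2 = x * (l / (1 + d)).
    by rewrite /x; field; apply/andP; split; lra.
  by rewrite ltr_pM2r.
apply: exp2_lt_fact.
rewrite -(ltr_nat R) !natrX -ltr_ln ?posrE ?exprn_gt0 //.
by rewrite !lnXn // -[ln 2 *+ _]mulr_natl -[_ *+ k]mulr_natl natrD natrM.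
Unshelve. all: by end_near. Qed.

(** With [L = log2 n] and [k <= n / (15 * L)], blocks of [2 * t <= 2 * (L + 2)]
    points suffice, and the [5 * k + 1] blocks occupy at most
    [2 / 3 * n + 4 / 3 * n / L + 2 * L + 4 <= n] points. *)
Lemma near_not_arrow : \forall n \near \oo, forall N,
  N%:R < n%:R + n%:R / (15 * log2 n%:R) :> R ->
  ~ ramsey_arrow N_poset (boolean_lattice n) N.
Proof.
have [ln2l ln2u] := ln2_bounds.
near=> n => N Nlt.
have [Nn|nN] := ltnP N n; first exact: not_arrow_small.
pose L := log2 (n%:R : R).
have n1 : 1 <= n%:R :> R by near: n; apply: nbhs_infty_ger.
have L8 : 8 <= L.
  rewrite /L /log2 ler_pdivlMr; last lra.
  by near: n; apply: near_ln_ge.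
have Ln : 2 * L + 4 <= n%:R / 6.
  have : ln (n%:R : R) + 2 * ln 2 <= ln 2 / 12 * n%:R.
    by near: n; apply: near_ln_sublinear; rewrite divr_gt0 //; lra.
  have -> : ln (n%:R : R) = L * ln 2 by rewrite /L /log2 divfK //; lra.
  have -> : L * ln 2 + 2 * ln 2 = (L + 2) * ln 2 by lra.
  have -> : ln 2 / 12 * n%:R = n%:R / 12 * ln 2 :> R by lra.
  rewrite ler_pM2r; lra.
pose k := (N - n)%N; have NE : N = (n + k)%N by rewrite /k; lia.
have kL : 15 * k%:R * L <= n%:R.
  move: Nlt; rewrite NE natrD ltrD2l -/L => /ltW; rewrite ler_pdivlMr; last lra.
  by lra.
pose t := (trunc_log 2 (2 * n)).+1.
have n_gt0 : (0 < n)%N by rewrite -(ltr_nat R); lra.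
have /andP[tlo thi] : (2 ^ t.-1 <= 2 * n < 2 ^ t)%N.
  by apply: trunc_log_bounds => //; lia.
have tL : t%:R <= L + 2.
  suff : t.-1%:R <= L + 1 by rewrite /t /= -natr1; lra.
  rewrite -(ler_pM2r (_ : 0 < ln 2)); last lra.
  have -> : (L + 1) * ln 2 = ln (2 * n%:R).
    by rewrite lnM ?posrE; [rewrite mulrDl /L /log2 divfK; lra|lra|lra].
  have -> : t.-1%:R * ln 2 = ln ((2 ^ t.-1)%N%:R) :> R.
    by rewrite natrX lnXn // mulr_natl.
  by rewrite ler_ln ?posrE ?ltr0n ?expn_gt0 //; [rewrite -natrM ler_nat|lra].
have kn : (k <= n)%N by rewrite -(ler_nat R); nra.
rewrite NE; apply: (@not_arrow_shrubs n k t) => //; first lia.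
rewrite -(ler_nat R) !natrM natrD -[(5 * k).+1%:R]natr1 natrM.
have t0 : 0 <= t%:R :> R by [].
have k0 : 0 <= k%:R :> R by [].
have kn' : 120 * k%:R <= n%:R :> R by nra.
nra.
Unshelve. all: by end_near. Qed.

End Asymptotics.

Lemma near_poset_ramsey_le (R : realType) (e : R) : 0 < e -> \forall n \near \oo,
  is_poset_ramsey N_poset (boolean_lattice n)
    (poset_ramsey N_poset (boolean_lattice n)) /\
  (poset_ramsey N_poset (boolean_lattice n))%:R
    <= n%:R + (1 + e) * n%:R / log2 n%:R :> R.
Proof.
move=> e0; near=> n.
have [k lt le] : exists2 k, (2 ^ (n + k) < k`!)%N &
    k%:R <= (1 + e) * n%:R / log2 (n%:R : R).
  by near: n; apply: near_fact_gt.
have n0 : (0 < n)%N by near: n; exists 1%N.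
have arrow := arrow_of_fact lt.
have P := poset_ramseyP (ltn_addr k n0) arrow; split=> //.
have [_ _ Pmin] := P.
have : (poset_ramsey N_poset (boolean_lattice n) <= n + k)%N.
  by apply: Pmin => //; apply: ltn_addr.
rewrite -(ler_nat R) natrD => leNk; apply: le_trans leNk _.
by rewrite lerD2l.
Unshelve. all: by end_near. Qed.

Theorem theorem4 (R : realType) :
  (\forall n \near \oo,
     n%:R + n%:R / (15 * log2 n%:R)
       <= (poset_ramsey N_poset (boolean_lattice n))%:R :> R) /\
  (exists2 eps : nat -> R, eps @ \oo --> 0 &
     \forall n \near \oo,
       (poset_ramsey N_poset (boolean_lattice n))%:R
         <= n%:R + (1 + eps n) * n%:R / log2 n%:R :> R).
Proof.
split.
  near=> n; rewrite leNgt; apply/negP => lt.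
  have [[_ arrow _] _] : is_poset_ramsey N_poset (boolean_lattice n)
      (poset_ramsey N_poset (boolean_lattice n)) /\
    (poset_ramsey N_poset (boolean_lattice n))%:R
      <= n%:R + (1 + 1) * n%:R / log2 n%:R :> R.
    by near: n; apply: near_poset_ramsey_le.
  move: arrow; suff : forall N, N%:R < n%:R + n%:R / (15 * log2 n%:R) :> R ->
    ~ ramsey_arrow N_poset (boolean_lattice n) N by apply.
  by near: n; apply: near_not_arrow.
pose r n : R := (poset_ramsey N_poset (boolean_lattice n))%:R.
have q_gt0 : \forall n \near \oo, 0 < n%:R / log2 (n%:R : R).
  near=> n; have l1 : 1 <= ln (n%:R : R) by near: n; apply: near_ln_ge.
  have n1 : 1 <= n%:R :> R by near: n; apply: nbhs_infty_ger.
  have [ln2 _] := ln2_bounds R.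
  by rewrite /log2 !divr_gt0 //; lra.
(* The least nonnegative error term for which the bound holds; that it tends to 0
   is what [near_poset_ramsey_le] says. *)
exists (fun n => Num.max 0 ((r n - n%:R) / (n%:R / log2 n%:R) - 1)).
  apply/cvgrPdist_le => e e0; near=> n.
  have q0 : 0 < n%:R / log2 (n%:R : R) by near: n.
  have [_ le] : is_poset_ramsey N_poset (boolean_lattice n)
      (poset_ramsey N_poset (boolean_lattice n)) /\
    (poset_ramsey N_poset (boolean_lattice n))%:R
      <= n%:R + (1 + e) * n%:R / log2 n%:R :> R.
    by near: n; apply: near_poset_ramsey_le.
  rewrite sub0r normrN ger0_norm ?le_max ?lexx // ge_max (ltW e0) /=.
  rewrite lerBlDr ler_pdivrMr // lerBlDl mulrA [e + 1]addrC; exact: le.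
near=> n.
have q0 : 0 < n%:R / log2 (n%:R : R) by near: n.
by rewrite -mulrA -lerBlDl -ler_pdivrMr // -lerBlDl le_max lexx orbT.
Unshelve. all: by end_near. Qed.
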